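(* Let $q$ be a prime power, $m\ge 1$, let $C$ be an $[n,k]$ cyclic code over $\mathbb{F}_{q^m}$ with $1\le k\le n-1$ and $n$ coprime with $q$, and let $1\le r\le k$. Then $d_r(\lambda(C))=r$ if and only if $\eta_q(C)\le n-r$.
   Context: An $[n,k]$ linear code over $\mathbb{F}_{q^m}$ is a $k$-dimensional $\mathbb{F}_{q^m}$-subspace $C$ of $\mathbb{F}_{q^m}^n$. It is cyclic with generator polynomial $g(x)$ (monic, dividing $x^n-1$, of degree $n-k$) if, identifying vectors with polynomials of degree $\le n-1$, $C$ is the ideal generated by $g(x)$ in $\mathbb{F}_{q^m}[x]/(x^n-1)$, i.e. $C=\{c(x)g(x) : c(x)\in\mathbb{F}_{q^m}[x],\ \deg c\le k-1\}$. For $1\le r\le k$, the $r$-th rank weight of $C$ (relative to $\mathbb{F}_q$) is $$d_r(\lambda(C))=\min\{\dim_{\mathbb{F}_{q^m}} V : V\in\Gamma(\mathbb{F}_{q^m}^n),\ \dim_{\mathbb{F}_{q^m}}(C\cap V)\ge r\},$$ where $\Gamma(\mathbb{F}_{q^m}^n)$ is the set of $\mathbb{F}_{q^m}$-linear subspaces $V\subset\mathbb{F}_{q^m}^n$ with $V^q=V$, and $V^q=\{(c_1^q,\dots,c_n^q) : (c_1,\dots,c_n)\in V\}$. Definition of $\eta_q(C)$ ($n$ coprime to $q$): let $m'$ be a multiple of $m$ such that $g(x)$ splits in $\mathbb{F}_{q^{m'}}[x]$; its roots are simple. Partition the roots of $g(x)$ into classes, two roots being in the same class if and only if they have the same minimal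 polynomial over $\mathbb{F}_q$, and choose one representative $\beta_1,\dots,\beta_s$ in each class. Then $\eta_q(C)=\sum_{j=1}^{s}[\mathbb{F}_q(\beta_j):\mathbb{F}_q]$. *)

(* Defs.v *)
From HB Require Import structures.
From mathcomp Require Import all_boot all_order all_algebra all_field.
From mathcomp Require Import boolp.

Set Implicit Arguments.
Unset Strict Implicit.
Unset Printing Implicit Defensive.

Import GRing.Theory.
Local Open Scope ring_scope.

Definition frobenius_row (L : fieldType) (n q : nat) (v : 'rV[L]_n) : 'rV[L]_n :=
  map_mx (fun x => x ^+ q) v.

(* V^q = V, as an equality of sets of vectors. *)
Definition frobenius_stable (L : fieldType) (n q : nat)
    (V : {vspace 'rV[L]_n}) : Prop :=
  forall w : 'rV[L]_n,
    (exists2 v : 'rV[L]_n, v \in V & w = frobenius_row q v) <-> w \in V.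

Definition rank_weight_dim (L : fieldType) (n q : nat)
    (C : {vspace 'rV[L]_n}) (r d : nat) : Prop :=
  exists V : {vspace 'rV[L]_n},
    [/\ frobenius_stable q V, (r <= \dim (C :&: V)%VS)%N & \dim V = d].

(* The unit n of the minimum is itself an admissible value (V the whole space)
   when r <= \dim C and L is a finite extension of a field with q elements: see
   rank_weightP. *)
Definition rank_weight (L : fieldType) (n q : nat)
    (C : {vspace 'rV[L]_n}) (r : nat) : nat :=
  \big[minn/n]_(d < n.+1 | `[< rank_weight_dim q C r d >]) (d : nat).

(* rVpoly identifies (c_0, ..., c_(n-1)) with \sum_i c_i 'X^i. *)
Definition cyclic_code (L : fieldType) (n k : nat)
    (C : {vspace 'rV[L]_n}) (g : {poly L}) : Prop :=
  [/\ \dim C = k,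
      g \is monic,
      g %| 'X^n - 1,
      size g = (n - k).+1
    & forall v : 'rV[L]_n,
        v \in C <-> exists2 c : {poly L}, (size c <= k)%N & rVpoly v = c * g].

(* The field M plays the part of a field with q ^ m' elements, m %| m', and
   iota that of the inclusion of L into it. *)
Definition splits_in (F : fieldType) (L M : fieldExtType F)
    (iota : 'AHom(L, M)) (g : {poly L}) : Prop :=
  exists rs : seq M, map_poly iota g %= \prod_(a <- rs) ('X - a%:P).

(* Roots of h are equivalent when they have the same minimal polynomial over F;
   bs contains exactly one element of each class. *)
Definition root_representatives (F : fieldType) (M : fieldExtType F)
    (h : {poly M}) (bs : seq M) : Prop :=
  [/\ {in bs, forall b, root h b},
      uniq [seq minPoly 1%VS b | b <- bs]
    & forall a, root h a -> exists2 b, b \in bs & minPoly 1%VS b = minPoly 1%VS a].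

Definition eta_q (F : fieldType) (M : fieldExtType F) (bs : seq M) : nat :=
  (\sum_(b <- bs) \dim <<1; b>>%VS)%N.

Lemma frobenius_stable_fullv (F : finFieldType) (L : fieldExtType F) (n : nat) :
  @frobenius_stable L n #|F| fullv.
Proof.
move=> w; split=> [_|_]; first exact: memvf.
pose m := (\dim {:L}).-1.
have dimL : \dim {:L} = m.+1 by rewrite prednK // adim_gt0.
have Hx (x : L) : x ^+ (#|F| ^ m.+1) = x.
  have card_L : #|finvect_type L| = (#|F| ^ m.+1)%N.
    have := card_vspace (fullv : {vspace finvect_type L}).
    by rewrite card_vspacef dimL.
  by rewrite -card_L; exact: (expf_card (x : finvect_type L)).
exists (map_mx (fun x => x ^+ (#|F| ^ m)) w); first exact: memvf.
by apply/rowP=> i; rewrite !mxE -exprM -expnSr Hx.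
Qed.

Lemma rank_weightP (F : finFieldType) (L : fieldExtType F) (n : nat)
    (C : {vspace 'rV[L]_n}) (r : nat) :
  (r <= \dim C)%N ->
  rank_weight_dim #|F| C r (rank_weight #|F| C r) /\
  (forall d, rank_weight_dim #|F| C r d -> rank_weight #|F| C r <= d)%N.
Proof.
move=> rC; split.
  apply: (big_ind (rank_weight_dim #|F| C r)) => [|x y Px Py|i /asboolP //].
    exists fullv; split; [exact: frobenius_stable_fullv | by rewrite capvf |].
    by rewrite dimvf /dim /= mul1n.
  by rewrite /minn; case: ifP.
move=> d Pd; have led : (d < n.+1)%N.
  case: Pd => V [_ _ <-]; have := dimvS (subvf V).
  by rewrite dimvf /dim /= mul1n.
rewrite /rank_weight.
have := mem_index_enum (Ordinal led).
elim: (index_enum _) => // i s IHs; rewrite inE big_cons => /predU1P[<-|/IHs les].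
  by rewrite asboolT //= geq_minl.
by case: ifP => // _; apply: leq_trans les; rewrite geq_minr.
Qed.

(* Main.v *)
Require Import Defs.
From HB Require Import structures.
From mathcomp Require Import all_boot all_order all_algebra all_field.
From mathcomp Require Import boolp.

Set Implicit Arguments.
Unset Strict Implicit.
Unset Printing Implicit Defensive.

Import GRing.Theory.
Local Open Scope ring_scope.

(** Let h be the product of the minimal polynomials over F_q of the
representatives: it has degree eta_q(C), coefficients in F_q, and g divides h
because the roots of g are simple.  The rank weight d_r equals r iff C contains
a Frobenius-stable subspace V of dimension r.  If eta_q(C) <= n - r, the
multiples c h with deg c < r form such a V.  Conversely, let v be in a stable
V contained in C: v is the Frobenius conjugate of order i of some u in V, and u
vanishes at each root b of g, so v vanishes at all the conjugates b^(q^i);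
hence h divides v, and V has dimension at most n - eta_q(C). *)

(** * Frobenius on a finite extension of F, and conjugates *)

Lemma card_finField_pchar (F : finFieldType) :
  exists p e, [/\ prime p, p \in [pchar F] & #|F| = (p ^ e.+1)%N].
Proof.
have [p p_pr pF] := finPcharP F.
have cF : #|F| = (p ^ logn p #|F|)%N := card_pprimeChar pF.
exists p, (logn p #|F|).-1; split=> //.
rewrite prednK // lt0n; apply/eqP => e0; move: cF (finNzRing_gt1 F).
by rewrite e0 => ->.
Qed.

Lemma coprime_card_natf_neq0 (F : finFieldType) (R : fieldExtType F) n :
  coprime n #|F| -> n%:R != 0 :> R.
Proof.
have [p [e [p_pr pF ->]]] := card_finField_pchar F.
rewrite coprime_pexpr // coprime_sym prime_coprime //.
by rewrite -(pchar_lalg R) in pF; rewrite (dvdn_pcharf pF).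
Qed.

(** Named so that it can carry a ring morphism structure; [frobenius_row] with exponent [#|F|] is
    convertible to [map_mx] of it. *)
Definition frob (F : finFieldType) (R : fieldExtType F) (x : R) : R :=
  x ^+ #|F|.

Section Frobenius.
Variables (F : finFieldType) (R : fieldExtType F).
Implicit Types (x : R) (p : {poly R}).

Lemma frob_is_zmod_morphism : zmod_morphism (@frob F R).
Proof.
move=> x y; have [p [e [_ pF oF]]] := card_finField_pchar F.
rewrite -(pchar_lalg R) in pF; rewrite /frob oF.
elim: e.+1 => // j IHj; rewrite expnSr !exprM {}IHj.
by rewrite -pFrobenius_autE rmorphB.
Qed.

Lemma frob_is_monoid_morphism : monoid_morphism (@frob F R).
Proof. by split=> [|x y]; rewrite /frob ?expr1n ?exprMn. Qed.

HB.instance Definition _ :=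
  GRing.isZmodMorphism.Build R R (@frob F R) frob_is_zmod_morphism.
HB.instance Definition _ :=
  GRing.isMonoidMorphism.Build R R (@frob F R) frob_is_monoid_morphism.

Lemma frob_eq1 x : (x \in 1%VS) = (frob x == x).
Proof. by rewrite Fermat's_little_theorem dimv1 expn1. Qed.

Lemma iter_frob i x : iter i (@frob F R) x = x ^+ (#|F| ^ i).
Proof. by elim: i => //= i ->; rewrite /frob -exprM -expnSr. Qed.

Lemma iter_frob_dim x : iter (\dim {:R}) (@frob F R) x = x.
Proof.
apply/eqP; rewrite iter_frob.
by rewrite -(Fermat's_little_theorem (fullv : {subfield R})) memvf.
Qed.

Lemma polyOver1_frob p : (p \is a polyOver 1%VS) = (map_poly (@frob F R) p == p).
Proof.
apply/polyOverP/eqP => [p1|fp i].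
  by apply/polyP=> i; rewrite coef_map; apply/eqP; rewrite -frob_eq1.
by rewrite frob_eq1 -[in X in _ == X]fp coef_map.
Qed.

(** The product of ['X - z%:P] over the distinct conjugates z of b is an intermediate divisor: it
    vanishes at b, and its roots are simple and lie among those of p. *)
Lemma minPoly_dvdp_conj b p :
  (forall i, root p (iter i (@frob F R) b)) -> minPoly 1 b %| p.
Proof.
move=> rp; pose N := \dim {:R}.
pose rs := undup [seq iter i (@frob F R) b | i <- iota 0 N].
have rsP i : (i < N)%N -> iter i (@frob F R) b \in rs.
  by move=> iN; rewrite mem_undup; apply/mapP; exists i; rewrite ?mem_iota.
have N0 : (0 < N)%N by apply: adim_gt0.
have urs : uniq rs := undup_uniq _.
have frs : perm_eq [seq frob x | x <- rs] rs.
  have uf : uniq [seq frob x | x <- rs] by rewrite map_inj_uniq //; apply: fmorph_inj.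
  (* Both lists are duplicate-free of equal length, so one inclusion suffices; the exponent i + 1 =
     N wraps around to b. *)
  apply: uniq_perm => //; apply: (uniq_min_size uf _ _).2; last by rewrite size_map.
  move=> _ /mapP[x + ->]; rewrite mem_undup => /mapP[i +->].
  rewrite mem_iota add0n /= => iN; rewrite -iterS.
  move: iN; rewrite leq_eqVlt => /predU1P[->|/rsP //].
  by rewrite iter_frob_dim; apply: (rsP 0).
apply: (@dvdp_trans _ (\prod_(z <- rs) ('X - z%:P))).
  (* Frobenius permutes rs, so this product has coefficients in F. *)
  apply: minPoly_dvdp; last by rewrite root_prod_XsubC; apply: (rsP 0).
  rewrite polyOver1_frob map_prod_XsubC.
  by rewrite -(big_map (@frob F R) xpredT (fun z => 'X - z%:P)) (perm_big _ frs).
apply: uniq_roots_dvdp; last by rewrite uniq_rootsE.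
by apply/allP => x; rewrite mem_undup => /mapP[i _ ->].
Qed.

End Frobenius.

(** * Products of minimal polynomials *)

Lemma coprimep_minPoly (K : fieldType) (E : fieldExtType K) (U : {subfield E})
    (a b : E) :
  minPoly U a != minPoly U b -> coprimep (minPoly U a) (minPoly U b).
Proof.
(* The gcd has coefficients in U, so by irreducibility it is constant or associate to both minimal
   polynomials, which are monic and would then be equal. *)
move=> ab; have gU : gcdp (minPoly U a) (minPoly U b) \is a polyOver U.
  by rewrite gcdp_polyOver ?minPolyOver.
case/orP: (minPoly_irr gU (dvdp_gcdl _ _)) => [ga|]; last by rewrite gcdp_eqp1.
case/orP: (minPoly_irr gU (dvdp_gcdr _ _)) => [gb|]; last by rewrite gcdp_eqp1.
case/negP: ab; rewrite -eqp_monic ?monic_minPoly //.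
by apply: eqp_trans gb; rewrite eqp_sym.
Qed.

(** Distinct minimal polynomials are coprime, so the divisibilities multiply one factor at a
    time. *)
Lemma prod_minPoly_dvdp (K : fieldType) (E : fieldExtType K) (U : {subfield E})
    (bs : seq E) (p : {poly E}) :
  uniq [seq minPoly U b | b <- bs] -> {in bs, forall b, minPoly U b %| p} ->
  \prod_(b <- bs) minPoly U b %| p.
Proof.
elim: bs => [_ _|b bs IHbs /= /andP[nb ubs] bsp]; first by rewrite big_nil dvd1p.
rewrite big_cons Gauss_dvdp.
  rewrite bsp ?mem_head //= IHbs // => c cbs.
  by apply: bsp; rewrite inE cbs orbT.
rewrite big_seq; elim/big_ind: _ => [|x y cx cy|c cbs].
- exact: coprimep1.
- by rewrite coprimepMr cx cy.
- by apply: coprimep_minPoly; apply: contraNneq nb => ->; apply: map_f.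
Qed.

Lemma size_prod_minPoly (K : fieldType) (E : fieldExtType K) (bs : seq E) :
  size (\prod_(b <- bs) minPoly 1 b) = (eta_q bs).+1.
Proof.
have mon (s : seq E) : \prod_(b <- s) minPoly 1 b \is monic.
  by apply: monic_prod => b _; apply: monic_minPoly.
rewrite /eta_q; elim: bs => [|b bs IHbs]; first by rewrite !big_nil size_poly1.
rewrite !big_cons size_monicM ?monic_minPoly ?monic_neq0 //.
by rewrite IHbs size_minPoly dim_Fadjoin dimv1 muln1 addnS.
Qed.

(** * Row vectors that are polynomial multiples of h *)

Definition mulp_row (L : fieldType) (d n : nat) (h : {poly L}) (c : 'rV[L]_d) :
  'rV[L]_n := poly_rV (rVpoly c * h).

Section PolynomialMultiples.
Variables (L : fieldType) (d n : nat) (h : {poly L}).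

Lemma mulp_row_is_linear : linear (@mulp_row L d n h).
Proof. by move=> a u v; rewrite /mulp_row linearP mulrDl -scalerAl linearP. Qed.

HB.instance Definition _ :=
  GRing.isLinear.Build L 'rV[L]_d 'rV[L]_n _ (@mulp_row L d n h) mulp_row_is_linear.

Definition multiples : {vspace 'rV[L]_n} := limg (linfun (@mulp_row L d n h)).

Lemma dim_multiples_le : (\dim multiples <= d)%N.
Proof.
rewrite -[X in (_ <= X)%N](_ : \dim {:'rV[L]_d} = d); last by rewrite dimvf /dim /= mul1n.
by rewrite /multiples -(limg_ker_dim (linfun (@mulp_row L d n h)) fullv) leq_addl.
Qed.

Hypotheses (h0 : h != 0) (hdn : (d + size h <= n.+1)%N).

(** Degrees stay below n, so [poly_rV] truncates nothing and [mulp_row] is exact multiplication by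
    h. *)
Lemma size_mulp_le (c : {poly L}) : (size c <= d)%N -> (size (c * h)%R <= n)%N.
Proof.
move=> cd; apply: leq_trans (size_mul_leq _ _) _.
by rewrite -subn1 leq_subLR add1n (leq_trans _ hdn) // leq_add2r.
Qed.

Lemma mem_multiples (v : 'rV[L]_n) :
  v \in multiples <-> exists2 c : {poly L}, (size c <= d)%N & rVpoly v = c * h.
Proof.
split=> [/memv_imgP[u _ ->]|[c cd vc]].
  exists (rVpoly u); first exact: size_poly.
  by rewrite lfunE /= poly_rV_K // size_mulp_le // size_poly.
apply/memv_imgP; exists (poly_rV c); first exact: memvf.
by rewrite lfunE /= /mulp_row poly_rV_K // -vc rVpolyK.
Qed.

Lemma dim_multiples : \dim multiples = d.
Proof.
rewrite limg_dim_eq; first by rewrite dimvf /dim /= mul1n.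
apply/eqP; rewrite -subv0; apply/subvP => u; rewrite memv_cap memv_ker lfunE /=.
case/andP=> _ /eqP/(congr1 rVpoly); rewrite poly_rV_K ?size_mulp_le ?size_poly //.
rewrite linear0 => /eqP; rewrite mulf_eq0 (negPf h0) orbF => /eqP u0.
by rewrite -(rVpolyK u) u0 linear0 mem0v.
Qed.

End PolynomialMultiples.

(** * Frobenius-stable subspaces and the rank weight *)

Lemma frobenius_stable_multiples (F : finFieldType) (L : fieldExtType F)
    (d n : nat) (h : {poly L}) :
  h \is a polyOver 1%VS -> h != 0 -> (d + size h <= n.+1)%N ->
  frobenius_stable #|F| (multiples d n h).
Proof.
rewrite polyOver1_frob => /eqP fh h0 hdn w.
have fW (v : 'rV[L]_n) :
    v \in multiples d n h -> map_mx (@frob F L) v \in multiples d n h.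
  case/(mem_multiples hdn)=> c cd vc; apply/(mem_multiples hdn).
  by exists (map_poly (@frob F L) c); rewrite ?size_map_poly // -map_rVpoly vc rmorphM /= fh.
split=> [[v /fW + ->] //|wW].
(* The iterate of order N + 1 of Frobenius is the identity on L, so the N-th one gives a preimage of
   w. *)
pose N := (\dim {:L}).-1.
exists (iter N (map_mx (@frob F L)) w); first by elim: N => //= i; apply: fW.
rewrite -[frobenius_row _ _]/(map_mx (@frob F L) _) -iterS prednK ?adim_gt0 //.
apply/rowP=> i; rewrite -[LHS]iter_frob_dim.
by elim: (\dim _) => //= j IHj; rewrite mxE -IHj.
Qed.

(** Each induction step replaces v by a preimage u in V: applying Frobenius to u(c) = 0 gives v(c^q)
    = 0. *)
Lemma frobenius_stable_root (F : finFieldType) (L M : fieldExtType F)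
    (iota : 'AHom(L, M)) (n : nat) (V : {vspace 'rV[L]_n}) (b : M) (i : nat)
    (v : 'rV[L]_n) :
  frobenius_stable #|F| V ->
  (forall u, u \in V -> root (map_poly iota (rVpoly u)) b) ->
  v \in V -> root (map_poly iota (rVpoly v)) (iter i (@frob F M) b).
Proof.
move=> sV; elim: i v => [|i IHi] v rb; first exact: rb.
case/sV=> u uV ->; have := IHi u rb uV; set c := iter i _ _ => /rootP uc.
rewrite -[frobenius_row _ _]/(map_mx (@frob F L) _) -map_rVpoly.
have -> : map_poly iota (map_poly (@frob F L) (rVpoly u)) =
          map_poly (@frob F M) (map_poly iota (rVpoly u)).
  by apply/polyP=> j; rewrite !coef_map /= rmorphXn.
by apply/rootP; rewrite iterS -/c horner_map uc rmorph0.
Qed.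

(** Admissible dimensions are at least r, since C :&: V lies in V; when dim V = r, the bound on C
    :&: V forces V inside C. *)
Lemma rank_weight_eqP (F : finFieldType) (L : fieldExtType F) (n r : nat)
    (C : {vspace 'rV[L]_n}) : (r <= \dim C)%N ->
  rank_weight #|F| C r = r <->
  exists V, [/\ frobenius_stable #|F| V, (V <= C)%VS & \dim V = r].
Proof.
move=> rC; have [ach min] := rank_weightP rC.
have lb d : rank_weight_dim #|F| C r d -> (r <= d)%N.
  by case=> V [_ rV <-]; apply: leq_trans rV (dimvS (capvSr _ _)).
split=> [wr|[V [sV VC dV]]]; last first.
  apply/eqP; rewrite eqn_leq lb // andbT; apply: min.
  by exists V; rewrite (capv_idPr VC) dV.
rewrite wr in ach; case: ach => V [sV rV dV]; exists V; split=> //.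
apply/capv_idPr/eqP; rewrite eqEdim capvSr dV; exact: rV.
Qed.

Theorem proposition5 (q m n k r : nat)
    (F : finFieldType) (hq : #|F| = q)
    (L : fieldExtType F) (hm : \dim {:L} = m)
    (hk : (1 <= k <= n - 1)%N) (hn : coprime n q) (hr : (1 <= r <= k)%N)
    (C : {vspace 'rV[L]_n}) (g : {poly L}) (hC : cyclic_code k C g)
    (M : fieldExtType F) (iota : 'AHom(L, M)) (hsplit : splits_in iota g)
    (bs : seq M) (hbs : root_representatives (map_poly iota g) bs) :
  rank_weight q C r = r <-> (eta_q bs <= n - r)%N.
Proof.
case: hC hbs hsplit => dC _ gn sg Cg [bsg ubs gbs] [rs grs]; subst q.
case/andP: hk hr => _ kn /andP[r0 rk].
have rn : (r <= n)%N by apply: leq_trans rk (leq_trans kn (leq_subr _ _)).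
pose H : {poly M} := \prod_(b <- bs) minPoly 1 b.
(* H descends to F and is lifted to L as h, where it can be compared with g and the codewords;
   divisibility over L is tested in M through [iota]. *)
have [h0 Hh0] : exists h0 : {poly F}, H = map_poly (in_alg M) h0.
  by apply/polyOver1P/rpred_prod => b _; apply: minPolyOver.
pose h : {poly L} := map_poly (in_alg L) h0.
have h1 : h \is a polyOver 1%VS by apply/polyOver1P; exists h0.
have ih : map_poly iota h = H.
  by rewrite Hh0; apply/polyP=> i; rewrite !coef_map /= linearZ rmorph1.
have sh : size h = (eta_q bs).+1 by rewrite -(size_map_poly iota) ih size_prod_minPoly.
have hN0 : h != 0 by rewrite -size_poly_gt0 sh.
have gH : map_poly iota g %| H.
  rewrite (eqp_dvdl _ grs); apply: uniq_roots_dvdp.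
    apply/allP=> a; rewrite -root_prod_XsubC -(eqp_root grs).
    case/gbs=> b bbs ab; rewrite /root /H horner_prod prodf_seq_eq0.
    by apply/hasP; exists b => //=; rewrite ab; apply: root_minPoly.
  (* [rs] has no repetition: g divides ['X^n - 1], which is separable because n is nonzero in M. *)
  rewrite uniq_rootsE -separable_prod_XsubC -(eqp_separable grs).
  apply: (@dvdp_separable _ ('X^n - 1)).
    have := gn; rewrite -(dvdp_map iota) rmorphB rmorph1 /= map_polyXn; exact.
  by rewrite cyclotomic.separable_Xn_sub_1 // coprime_card_natf_neq0.
have gh : g %| h by rewrite -(dvdp_map iota) ih.
rewrite rank_weight_eqP ?dC //; split=> [[V [sV VC dV]]|etar].
  have hV v : v \in V -> h %| rVpoly v.
    move=> vV; rewrite -(dvdp_map iota) ih; apply: prod_minPoly_dvdp ubs _ => b bbs.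
    apply: minPoly_dvdp_conj => i; apply: (@frobenius_stable_root F L M iota n V) vV => // u uV.
    have /Cg[c _ ->] : u \in C by apply: subvP VC u uV.
    by rewrite rmorphM rootM bsg ?orbT.
  (* As r > 0, [vpick V] is nonzero and divisible by h, so size h <= n; hence [n - eta_q bs] is not
     truncated. *)
  have etan : (eta_q bs < n)%N.
    rewrite -sh; apply: leq_trans (size_poly _ _); apply: dvdp_leq (hV _ (memv_pick V)).
    apply: contraTneq r0 => /(congr1 (poly_rV (d := n))); rewrite rVpolyK linear0.
    by move/eqP; rewrite vpick0 => /eqP V0; rewrite -dV V0 dimv0.
  rewrite leq_subRL //.
  rewrite addnC -leq_subRL ?(ltnW etan) // -dV.
  (* V lies in the space of products c h with size c <= n - eta_q. *)
  apply: leq_trans (dim_multiples_le (n - eta_q bs) n h); apply: dimvS.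
  apply/subvP=> v vV; apply/mem_multiples=> //.
    by rewrite sh addnS subnK // ltnW.
  have /dvdpP[c vc] := hV v vV; exists c => //.
  have [->|c0] := eqVneq c 0; first by rewrite size_poly0.
  have : (size (rVpoly v) <= n)%N by apply: size_poly.
  rewrite vc size_mul // sh addnS /=.
  by rewrite leq_subRL ?(ltnW etan) // addnC.
exists (multiples r n h).
have hdn : (r + size h <= n.+1)%N by rewrite sh addnS ltnS -leq_subRL.
split; [exact: frobenius_stable_multiples| |exact: dim_multiples].
apply/subvP=> v /mem_multiples[]// c cr vc; apply/Cg.
(* With h = e g, the codeword is (c e) g; it has size at most n and g has size n - k + 1, which
   leaves at most k for c e. *)
have /dvdpP[e he] := gh; exists (c * e); last by rewrite vc he mulrA.
have [->|ce0] := eqVneq (c * e) 0; first by rewrite size_poly0.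
have kn' : (k <= n)%N by apply: leq_trans kn (leq_subr _ _).
have : (size (rVpoly v) <= n)%N by apply: size_poly.
rewrite vc he mulrA size_mul // ?sg; last by rewrite -size_poly_gt0 sg.
by rewrite addnS /= -[X in (_ <= X)%N -> _](subnKC kn') leq_add2r.
Qed.
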